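(* Let $G$ be a graph on $n\ge 2$ vertices whose diameter is at most $2$, and let $k=|D(G)|/2$. Then $$\lambda_2(G)\ \ge\ \frac{n-k+1-\sqrt{(n-k+1)^2-4(n-2k)}}{2}.$$
   Context: Graphs are finite, simple and undirected. The Laplacian of a graph on $n$ vertices is $L=\Delta-A$, where $\Delta$ is the diagonal matrix of degrees and $A$ is the adjacency matrix; its eigenvalues are listed as $0=\lambda_1(G)\le\lambda_2(G)\le\cdots\le\lambda_n(G)$ with multiplicity. $d(x,v)$ denotes graph distance (equal to $\infty$ if $x,v$ lie in different components), the diameter is the maximum distance between two vertices, and $D(G)=\{v\in V(G): \text{there is some } x\in V(G)\text{ with } d(x,v)\ge 3\}$. *)

(* Defs.v *)
From HB Require Import structures.
From mathcomp Require Import all_boot all_order all_algebra.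
From mathcomp Require Import complex polyrcf.

Set Implicit Arguments.
Unset Strict Implicit.
Unset Printing Implicit Defensive.

Import Order.TTheory GRing.Theory Num.Theory.
Local Open Scope ring_scope.

Record sgraph := SGraph {
  vertex :> finType;
  adj : rel vertex;
  adj_sym : symmetric adj;
  adj_irrefl : irreflexive adj }.

(* Natural numbers extended with an infinite element: [None] is infinity. *)
Definition enat := option nat.

Definition ele (a b : enat) : bool :=
  match a, b with
  | _, None => true
  | None, Some _ => false
  | Some i, Some j => (i <= j)%N
  end.

Definition emax (a b : enat) : enat := if ele a b then b else a.

Section Distance.
Variable G : sgraph.
Implicit Types x y v : G.

(* There is a walk with exactly [m] edges from [x] to [y]. *)
Definition walk x y (m : nat) : bool :=
  [exists p : m.-tuple G, path (@adj G) x p && (last x p == y)].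

Lemma connect_walk x y : connect (@adj G) x y -> exists m, walk x y m.
Proof.
move=> /connectP[p xp ->]; exists (size p); apply/existsP.
by exists (in_tuple p); rewrite xp eqxx.
Qed.

Definition dist x y : enat :=
  if @idP (connect (@adj G) x y) is ReflectT xy
  then Some (ex_minn (connect_walk xy)) else None.

Definition diam : enat :=
  \big[emax/Some 0%N]_(x : G) \big[emax/Some 0%N]_(y : G) dist x y.

Definition far_set : {set G} :=
  [set v | [exists x, ele (Some 3%N) (dist x v)]].

End Distance.

Section Laplacian.
Variables (R : rcfType) (G : sgraph).

Definition deg (v : G) : nat := #|[set w | adj v w]|.

Definition degree_mx : 'M[R]_#|G| := diag_mx (\row_i (deg (enum_val i))%:R).

Definition adjacency_mx : 'M[R]_#|G| :=
  \matrix_(i, j) (adj (enum_val i) (enum_val j))%:R.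

Definition laplacian : 'M[R]_#|G| := degree_mx - adjacency_mx.

End Laplacian.

(* The eigenvalues of [A] in [R] in nondecreasing order, each repeated according
   to its multiplicity as a root of the characteristic polynomial. *)
Definition spectrum (R : rcfType) (n : nat) (A : 'M[R]_n) : seq R :=
  flatten [seq nseq (mup x (char_poly A)) x | x <- rootsR (char_poly A)].

(* The [i]-th smallest Laplacian eigenvalue, indexed from 1; meaningful for
   [1 <= i <= #|G|], see [size_spectrum_laplacian]. *)
Definition lapl_eigenvalue (R : rcfType) (G : sgraph) (i : nat) : R :=
  (spectrum (laplacian R G))`_i.-1.

Lemma spectrum_sorted (R : rcfType) (n : nat) (A : 'M[R]_n) :
  sorted <=%R (spectrum A).
Proof.
rewrite /spectrum; move: (char_poly A) => p.
have: sorted <%R (rootsR p) by exact: sorted_roots.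
elim: (rootsR p) => //= x s IHs; rewrite (path_sortedE lt_trans).
move=> /andP[/allP xs /IHs {}IHs].
elim: (mup x p) => //= k IHk; rewrite (path_sortedE le_trans) IHk andbT.
apply/allP => y; rewrite mem_cat => /orP[/nseqP[-> _] //|].
by move=> /flatten_mapP[z zs /nseqP[-> _]]; apply/ltW/xs.
Qed.

Lemma char_poly_similar (F : fieldType) (n : nat) (P A : 'M[F]_n) :
  P \in unitmx -> char_poly (invmx P *m A *m P) = char_poly A.
Proof.
move=> Pu; rewrite /char_poly; set Q := map_mx polyC P.
have VQ : map_mx polyC (invmx P) *m Q = 1%:M.
  by rewrite -map_mxM mulVmx // map_mx1.
have -> : char_poly_mx (invmx P *m A *m P) =
          map_mx polyC (invmx P) *m char_poly_mx A *m Q.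
  rewrite /char_poly_mx !map_mxM mulmxBr mulmxBl; congr (_ - _).
  by rewrite mul_mx_scalar -scalemxAl VQ scalemx1.
by rewrite !det_mulmx mulrAC -det_mulmx VQ det1 mul1r.
Qed.

Lemma symmetric_char_poly_split (R : rcfType) (n : nat) (A : 'M[R]_n) :
  A^T = A -> exists s : seq R, char_poly A = \prod_(x <- s) ('X - x%:P).
Proof.
move=> Asym; pose f := real_complex R; pose B := map_mx f A.
have Bherm : B \is hermsymmx.
  apply: realsym_hermsym; first by apply/is_hermitianmxP;
    rewrite expr0 scale1r map_mx_id // /B map_trmx Asym.
  by apply/mxOverP => i j; rewrite mxE; apply/complex_realP; exists (A i j).
have spR := hermitian_spectral_diag_real Bherm.
have /hermitian_normalmx/orthomx_spectralP eqB := Bherm.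
have Pu := spectral_unit B.
move: (spectral_diag B) (spectralmx B) spR eqB Pu => d P dR eqB Pu.
exists [seq complex.Re (d 0 i) | i <- enum 'I_n].
apply: (map_poly_inj f).
rewrite map_char_poly -/B eqB char_poly_similar //.
rewrite char_poly_trig ?diag_mx_is_trig // big_map big_enum rmorph_prod /=.
apply: eq_bigr => i _; rewrite rmorphB /= map_polyX map_polyC /= mxE eqxx.
rewrite mulr1n; congr (_ - _%:P); symmetry; apply: RRe_real.
exact: (elimT mxOverP dR).
Qed.

Lemma char_poly_spectrum (R : rcfType) (n : nat) (A : 'M[R]_n) :
  A^T = A -> char_poly A = \prod_(x <- spectrum A) ('X - x%:P).
Proof.
move=> /symmetric_char_poly_split[s def_p]; rewrite [LHS]def_p.
apply: perm_big; rewrite /spectrum.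
have p0 : char_poly A != 0 by rewrite monic_neq0 ?char_poly_monic.
apply/allP => y _ /=; rewrite count_flatten -map_comp.
have rP := roots_on_rootsR p0 y; rewrite in_itv /= in rP.
have ru : uniq (rootsR (char_poly A)).
  by apply: sorted_uniq lt_trans ltxx _ _; exact: sorted_roots.
rewrite -mu_prod_XsubC -def_p eq_sym; apply/eqP.
rewrite sumnE big_map; have [yr|yr] := boolP (y \in rootsR (char_poly A)).
  rewrite (bigD1_seq y) //= count_nseq /= eqxx mul1n big1 ?addn0 // => x xy.
  by rewrite count_nseq /= (negPf xy).
rewrite big1_seq => [|x /= xr].
  by rewrite mupNroot // rP.
rewrite count_nseq /=; have [xy|//] := eqVneq x y.
by rewrite -xy xr in yr.
Qed.

Lemma laplacian_sym (R : rcfType) (G : sgraph) :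
  (laplacian R G)^T = laplacian R G.
Proof.
apply/matrixP => i j; rewrite !mxE adj_sym eq_sym.
by case: eqVneq => [->|].
Qed.

Lemma size_spectrum_laplacian (R : rcfType) (G : sgraph) :
  size (spectrum (laplacian R G)) = #|G|.
Proof.
have := size_char_poly (laplacian R G).
by rewrite char_poly_spectrum ?laplacian_sym // size_prod_XsubC => -[].
Qed.

(* Main.v *)
(* A graph of diameter at most 2 has [far_set G = set0], so [k = 0] and the
   claimed bound is [1]. Let [x] be a nonzero eigenvector with eigenvalue
   [a < 1] and entries summing to 0, and let [v] be a vertex where [x] is
   maximal. The terms of [\sum_(w ~ v) (x v - x w) = a * x v < x v] are
   nonnegative, so each is less than [x v]: [x] is positive on [v] and all its
   neighbours. Likewise [x] is negative on the closed neighbourhood of a vertex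
   where it is minimal, but in diameter at most 2 the two closed neighbourhoods
   meet. Hence an eigenvalue below 1 has only constant eigenvectors, so it is 0
   and, the Laplacian being symmetric, simple. *)
Require Import Defs.
From mathcomp Require Import all_boot all_order all_algebra.
From mathcomp Require Import complex polyrcf lra zify.

Import Order.TTheory GRing.Theory Num.Theory.
Local Open Scope ring_scope.

(** * Distances when the diameter is at most 2 *)

Lemma ele_emax (a b c : enat) : ele (emax a b) c = ele a c && ele b c.
Proof.
rewrite /emax; case: a b c => [a|] [b|] [c|] //=; rewrite ?andbF ?andbT //;
  case: ifP => //= ab; lia.
Qed.

Lemma ele_big_emax (T : finType) (F : T -> enat) (b : enat) (t : T) :
  ele (\big[emax/Some 0%N]_(x : T) F x) b -> ele (F t) b.
Proof.
have: t \in index_enum T by rewrite mem_index_enum.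
elim: (index_enum T) => //= x s IHs; rewrite inE big_cons ele_emax.
by case/predU1P=> [->|/IHs sF] /andP[].
Qed.

Lemma dist_le_diam (G : sgraph) (b : enat) (x y : G) :
  ele (diam G) b -> ele (dist x y) b.
Proof. by move=> /(@ele_big_emax _ _ _ x)/(@ele_big_emax _ _ _ y). Qed.

Lemma far_set_diam2 (G : sgraph) :
  ele (diam G) (Some 2%N) -> far_set G = set0.
Proof.
move=> hdiam; apply/setP => v; rewrite !inE; apply/existsP => -[x].
by have := dist_le_diam _ _ x v hdiam; case: (dist x v) => //= m; lia.
Qed.

Lemma dist_walk (G : sgraph) (x y : G) (m : nat) :
  dist x y = Some m -> walk x y m.
Proof.
rewrite /dist; case: {-}_ / idP => // xy [<-].
by case: ex_minnP.
Qed.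

Lemma closed_neighbourhoods_meet (G : sgraph) (x y : G) :
  ele (diam G) (Some 2%N) ->
  exists2 w, (w == x) || adj x w & (w == y) || adj y w.
Proof.
move=> /dist_le_diam-/(_ x y); case E: (dist x y) => [m|//] /= m2.
have /existsP[[p /= /eqP sp] /andP[xp /eqP <-]] := dist_walk _ _ _ _ E.
(* For a walk of length 0, 1 or 2, the common vertex is its start, its end or its middle vertex
   respectively. *)
case: p sp xp => [|w [|z [|? ?]]] /=; last lia.
- by exists x; rewrite eqxx.
- by move=> _ /andP[xw _]; exists w; rewrite ?eqxx ?xw ?orbT.
- move=> _ /and3P[xw wz _]; exists w; first by rewrite xw orbT.
  by rewrite adj_sym wz orbT.
Qed.

(** * Laplacian eigenvectors for eigenvalues below 1 *)

Section LaplacianEigenvectors.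
Variables (R : rcfType) (G : sgraph).
Implicit Types (x : G -> R) (a : R).

(** Stated for functions on vertices, so that the extremal argument does not involve the numbering
    of vertices that indexes the matrices. *)
Definition lap_eigenfun a x :=
  forall v, \sum_(w | adj v w) (x v - x w) = a * x v.

Lemma eigenfun_max_nbhd a x v w :
  a < 1 -> lap_eigenfun a x -> (forall u, x u <= x v) -> 0 < x v ->
  (w == v) || adj v w -> 0 < x w.
Proof.
move=> a1 eig vmax v0 /predU1P[-> //|vw].
have := eig v; rewrite (bigD1 w) //= => E.
have S0 : 0 <= \sum_(i | adj v i && (i != w)) (x v - x i).
  by apply: sumr_ge0 => i _; rewrite subr_ge0.
have : a * x v < x v by rewrite gtr_pMl.
lra.
Qed.

(** If the maximum were at most 0, all [- x i] would be nonnegative with sum 0, hence all zero. *)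
Lemma sum0_max_gt0 x v :
  \sum_u x u = 0 -> (forall u, x u <= x v) -> (exists u, x u != 0) -> 0 < x v.
Proof.
move=> s0 vmax [u u0]; rewrite ltNge; apply/negP => v0.
have ge0 i : true -> 0 <= - x i by rewrite oppr_ge0 (le_trans (vmax i)).
have sN0 : \sum_i - x i = 0 by rewrite sumrN s0 oppr0.
have /eqP : - x u = 0 by exact: psumr_eq0P ge0 sN0 _ _.
by rewrite oppr_eq0 (negPf u0).
Qed.

Lemma eigenfun_sum0_eq0 a x :
  ele (diam G) (Some 2%N) -> a < 1 -> lap_eigenfun a x -> \sum_v x v = 0 ->
  forall v, x v = 0.
Proof.
move=> hdiam a1 eig s0 v; apply/eqP/negPn/negP => v0.
have xn0 : exists u, x u != 0 by exists v.
(* A minimum of [x] is a maximum of [y], so the lemmas about maxima cover both ends. *)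
pose y u := - x u.
have eigy : lap_eigenfun a y.
  move=> u; rewrite mulrN -eig -sumrN; apply: eq_bigr => w _.
  by rewrite /y opprB opprK addrC.
have sy0 : \sum_u y u = 0 by rewrite sumrN s0 oppr0.
have yn0 : exists u, y u != 0 by exists v; rewrite oppr_eq0.
have [p _ pmax] := arg_maxP x (erefl (predT v)).
have [q _ qmax] := arg_maxP y (erefl (predT v)).
have pm u : x u <= x p by exact: pmax.
have qm u : y u <= y q by exact: qmax.
have [w wp wq] := closed_neighbourhoods_meet _ p q hdiam.
have := eigenfun_max_nbhd _ _ _ _ a1 eig pm (sum0_max_gt0 _ _ s0 pm xn0) wp.
have := eigenfun_max_nbhd _ _ _ _ a1 eigy qm (sum0_max_gt0 _ _ sy0 qm yn0) wq.
rewrite /y; lra.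
Qed.

Lemma mul_laplacian (u : 'rV[R]_#|G|) (v : G) :
  (u *m laplacian R G) 0 (enum_rank v) =
  \sum_(w | adj v w) (u 0 (enum_rank v) - u 0 (enum_rank w)).
Proof.
rewrite /laplacian mulmxBr mul_mx_diag !mxE enum_rankK sumrB; congr (_ - _).
  by rewrite sumr_const mulr_natr; congr (_ *+ _); apply: eq_card => w; rewrite inE.
rewrite (reindex _ (onW_bij _ (enum_rank_bij G))) /= [RHS]big_mkcond /=.
apply: eq_bigr => w _; rewrite mxE !enum_rankK adj_sym.
by case: ifP => _; rewrite ?mulr1 ?mulr0.
Qed.

Lemma laplacian_eigenfun a (u : 'rV[R]_#|G|) :
  u *m laplacian R G = a *: u -> lap_eigenfun a (fun v => u 0 (enum_rank v)).
Proof. by move=> eig v; rewrite -mul_laplacian eig mxE. Qed.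

Lemma mul_laplacian1 (c : R) : const_mx c *m laplacian R G = 0 :> 'rV_#|G|.
Proof.
apply/rowP => i; rewrite -(enum_valK i) mul_laplacian [RHS]mxE big1 // => w _.
by rewrite !mxE subrr.
Qed.

(** Pair the eigenvector equation with the all-ones vector, which the symmetric Laplacian kills. *)
Lemma laplacian_eigenvector_sum a (u : 'rV[R]_#|G|) :
  u *m laplacian R G = a *: u -> a * \sum_i u 0 i = 0.
Proof.
move=> eig; have sumE (z : 'rV[R]_#|G|) :
    \sum_i z 0 i = (z *m (const_mx 1)^T :> 'M_1) 0 0.
  by rewrite mxE; apply: eq_bigr => i _; rewrite !mxE mulr1.
have -> : a * \sum_i u 0 i = \sum_i (a *: u) 0 i.
  by rewrite mulr_sumr; apply: eq_bigr => i _; rewrite mxE.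
rewrite -eig sumE -mulmxA -{1}laplacian_sym -trmx_mul mul_laplacian1.
by rewrite trmx0 mulmx0 mxE.
Qed.

Hypothesis hdiam : ele (diam G) (Some 2%N).

Lemma laplacian_eigenvector_sum0 a (u : 'rV[R]_#|G|) :
  a < 1 -> u *m laplacian R G = a *: u -> \sum_i u 0 i = 0 -> u = 0.
Proof.
move=> a1 /laplacian_eigenfun eig s0.
apply/rowP => i; rewrite -(enum_valK i) mxE.
apply: (eigenfun_sum0_eq0 _ _ hdiam a1 eig).
by rewrite -(reindex _ (onW_bij predT (enum_rank_bij G))).
Qed.

(** A nonzero eigenvalue forces the entries of its eigenvectors to sum to 0, and below 1 such
    eigenvectors vanish. *)
Lemma laplacian_root_lt1 a :
  a < 1 -> root (char_poly (laplacian R G)) a -> a = 0.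
Proof.
rewrite -eigenvalue_root_char => a1 /eigenvalueP[u eig u0].
apply/eqP/negPn/negP => a0; case/eqP: u0.
apply: (laplacian_eigenvector_sum0 _ _ a1 eig).
by have /eqP := laplacian_eigenvector_sum _ _ eig; rewrite mulf_eq0 (negPf a0) => /eqP.
Qed.

Lemma rank_laplacian_ker :
  (0 < #|G|)%N -> (\rank (eigenspace (laplacian R G) 0) <= 1)%N.
Proof.
move=> n0; apply: leq_trans (rank_leq_row (const_mx 1 : 'rV[R]_#|G|)).
apply/mxrankS/row_subP => i.
have /eigenspaceP := row_sub i (eigenspace (laplacian R G) 0).
move: (row i _) => u eig.
(* Subtracting the mean [m] from a kernel vector leaves a kernel vector with entry sum 0, which
   vanishes since 0 < 1. *)
pose m := (\sum_i u 0 i) / #|G|%:R.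
suff -> : u = m *: const_mx 1 by exact: scalemx_sub.
apply/eqP; rewrite -subr_eq0; apply/eqP.
apply: (laplacian_eigenvector_sum0 _ _ ltr01).
  by rewrite mulmxBl eig -scalemxAl mul_laplacian1 !(scale0r, scaler0) subrr.
under eq_bigr do rewrite !mxE mulr1.
rewrite sumrB sumr_const card_ord -mulr_natr mulfVK ?subrr //.
by rewrite pnatr_eq0 -lt0n.
Qed.

End LaplacianEigenvectors.

(** * Multiplicities of eigenvalues of real symmetric matrices *)

Lemma rank_diag_mx_le (F : fieldType) (n : nat) (d : 'rV[F]_n) :
  (\rank (diag_mx d) <= #|[pred i | d 0%R i != 0%R]|)%N.
Proof.
rewrite diag_mx_sum_delta -sum1_card [leqRHS]big_mkcond /=.
apply: (big_rec2 (fun (A : 'M[F]_n) (r : nat) => (\rank A <= r)%N)) => [|i A r _ rA];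
  first by rewrite mxrank0.
apply: leq_trans (mxrank_add _ _) (leq_add _ rA).
rewrite inE; case: eqVneq => [->|d0] /=; first by rewrite scale0r mxrank0.
by rewrite mxrank_scale_nz // mxrank_delta.
Qed.

(** Over the complex extension of [R] the matrix is diagonalizable, and both multiplicities can be
    read off the diagonal [d]. *)
Lemma mup_char_poly_sym (R : rcfType) (n : nat) (A : 'M[R]_n) (a : R) :
  A^T = A -> (mup a (char_poly A) <= \rank (eigenspace A a))%N.
Proof.
move=> Asym; pose f := real_complex R; pose B := map_mx f A.
have Bherm : B \is hermsymmx.
  apply: realsym_hermsym; first by apply/is_hermitianmxP;
    rewrite expr0 scale1r map_mx_id // /B map_trmx Asym.
  by apply/mxOverP => i j; rewrite mxE; apply/complex_realP; exists (A i j).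
have /hermitian_normalmx/orthomx_spectralP eqB := Bherm.
have Pu := spectral_unit B.
move: (spectral_diag B) (spectralmx B) eqB Pu => d P eqB Pu.
(* Compare the two factorizations of the complexified characteristic polynomial, by [spectrum A] and
   by [d]. *)
have -> : mup a (char_poly A) = #|[pred i | d 0 i == f a]|.
  have chE := char_poly_spectrum Asym.
  rewrite {1}chE mu_prod_XsubC; have := congr1 (map_poly f) chE.
  rewrite map_char_poly -/B eqB.
  rewrite char_poly_similar // char_poly_trig ?diag_mx_is_trig //.
  rewrite rmorph_prod /= => /(congr1 (mup (f a))).
  under eq_bigr do rewrite mxE eqxx mulr1n.
  under [in RHS]eq_bigr do rewrite rmorphB /= map_polyX map_polyC /=.
  rewrite -(big_map (fun i => d 0 i) xpredT (fun x => 'X - x%:P)).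
  rewrite -(big_map f xpredT (fun x => 'X - x%:P)) !mu_prod_XsubC !count_map.
  move=> E; transitivity (count (preim f (pred1 (f a))) (spectrum A)).
    by apply: eq_count => x /=; rewrite (inj_eq (fmorph_inj f)).
  by rewrite -E cardE size_filter; apply: eq_count.
(* Rank is unchanged by extending scalars and by conjugation, so that of [A - a%:M] is at most the
   number of entries of [d] other than [f a]. *)
rewrite mxrank_ker -(mxrank_map f) map_mxB map_scalar_mx -/B.
have -> : B - (f a)%:M = invmx P *m diag_mx (d - const_mx (f a)) *m P.
  rewrite linearB /= diag_const_mx mulmxBr mulmxBl -eqB.
  by rewrite mul_mx_scalar -scalemxAl mulVmx // scalemx1.
rewrite mxrankMfree ?row_free_unit // (eqmxMfull _ (_ : row_full (invmx P))).
  rewrite leq_subRL ?rank_leq_row // addnC.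
  apply: leq_trans (leq_add (leqnn _) (rank_diag_mx_le _ _ _)) _.
  rewrite -[leqRHS](card_ord n) -(cardC [pred i | d 0 i == f a]) leq_add2l.
  by apply: subset_leq_card; apply/subsetP => i; rewrite !inE !mxE subr_eq0.
by rewrite row_full_unit unitmx_inv.
Qed.

Theorem proposition3p1 (R : rcfType) (G : sgraph)
    (hn : (2 <= #|G|)%N) (hdiam : ele (diam G) (Some 2%N)) :
  let n : R := #|G|%:R in
  let k : R := #|far_set G|%:R / 2 in
  (n - k + 1 - Num.sqrt ((n - k + 1) ^+ 2 - 4 * (n - 2 * k))) / 2
    <= lapl_eigenvalue R G 2.
Proof.
rewrite /= far_set_diam2 // cards0 mul0r mulr0 !subr0.
(* With [k = 0] the discriminant is a perfect square and the bound equals 1. *)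
have -> : (#|G|%:R + 1) ^+ 2 - 4 * #|G|%:R = (#|G|%:R - 1) ^+ 2 :> R by lra.
have n1 : 1 <= #|G|%:R :> R by rewrite ler1n ltnW.
rewrite sqrtr_sqr ger0_norm ?subr_ge0 //.
suff : 1 <= lapl_eigenvalue R G 2 by lra.
rewrite /lapl_eigenvalue /= leNgt; apply/negP.
have := size_spectrum_laplacian R G; have := spectrum_sorted (laplacian R G).
have := char_poly_spectrum (laplacian_sym R G).
case: (spectrum _) => [|a [|b s]] chE.
- by move=> _ E; rewrite -E in hn.
- by move=> _ E; rewrite -E in hn.
move=> /= /andP[ab _] _ b1.
have rootE c : c \in [:: a, b & s] -> c < 1 -> c = 0.
  by move=> cs c1; apply: (laplacian_root_lt1 _ _ hdiam _ c1); rewrite chE root_prod_XsubC.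
have a0 : a = 0 by apply: rootE (le_lt_trans ab b1); rewrite mem_head.
have b0 : b = 0 by apply: rootE b1; rewrite !inE eqxx orbT.
(* If the second entry [b] were below 1, then [a] and [b] would both be 0, a root of multiplicity at
   least 2, while the kernel has dimension at most 1. *)
have := leq_trans (mup_char_poly_sym _ _ _ 0 (laplacian_sym R G))
  (rank_laplacian_ker _ _ hdiam (ltnW hn)).
by rewrite chE mu_prod_XsubC a0 b0 /= eqxx.
Qed.
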